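(* Let $x_+$ be the real number defined in the context. Then $$t(K_n)\le (2x_+ + o(1))\,n^2 = (4x_+ + o(1))\,|E(K_n)| < 0.637152\, n^2.$$
   Context: Let $y,z$ be the solution of the system $y'(x)=\frac{1}{1-z(x)}$, $z'(x)=\frac{1}{z(x)}-\frac{1}{1-z(x)}$ with $y(0)=z(0)=0$; $y+z$ is increasing, and $x_+$ is the value of $x$ for which $y(x)+z(x)=1$. Toppling game: on a graph $G$, configurations $c:V(G)\to\mathbb{N}\cup\{0\}$; a vertex with at least $\deg(v)$ chips may fire, losing $\deg(v)$ chips and sending one to each neighbour; a configuration is volatile if there is an infinite sequence of vertices that may be fired in order. Max and Min alternately place one chip on a vertex (Max first); the game ends once the configuration is volatile; Max maximizes and Min minimizes the number of chips placed. $t(G)$ is the length of the game under optimal play. *)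

(* Defs.v *)
From HB Require Import structures.
From mathcomp Require Import all_boot all_order all_algebra.
From mathcomp Require Import all_classical all_reals all_analysis.
Import Order.TTheory GRing.Theory Num.Theory numFieldNormedType.Exports.
Set Implicit Arguments.
Unset Strict Implicit.
Unset Printing Implicit Defensive.

Record sgraph := SGraph {
  vertex :> finType;
  adj : rel vertex;
  adj_sym : symmetric adj;
  adj_irrefl : irreflexive adj }.

Definition degree (G : sgraph) (v : G) : nat := #|[set u | adj v u]|.

Definition edges (G : sgraph) : {set {set G}} :=
  [set A : {set G} | [exists u, exists v, adj u v && (A == [set u; v])]].

Fact complete_sym n : symmetric [rel u v : 'I_n | u != v].
Proof. by move=> u v /=; rewrite eq_sym. Qed.

Fact complete_irrefl n : irreflexive [rel u v : 'I_n | u != v].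
Proof. by move=> u /=; rewrite eqxx. Qed.

Definition complete_graph (n : nat) : sgraph :=
  SGraph (@complete_sym n) (@complete_irrefl n).

Section TopplingGame.
Variable G : sgraph.

Definition config := {ffun G -> nat}.
Implicit Types (c : config) (v w : G).

Definition empty_config : config := [ffun=> 0%N].

Definition place c v : config := [ffun w => (c w + (w == v))%N].

Definition may_fire c v : bool := (degree v <= c v)%N.

(* The subtraction is truncated, but [fire] is only used when [may_fire c v]. *)
Definition fire c v : config :=
  [ffun w => (c w - (if w == v then degree v else 0) + adj v w)%N].

Definition volatile c : Prop :=
  exists s : nat -> G, forall i, may_fire (foldl fire c (mkseq s i)) (s i).

Inductive player := Max | Min.

Definition opponent (p : player) : player :=
  match p with Max => Min | Min => Max end.

Definition prefers (p : player) (k l : nat) : bool :=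
  match p with Max => (l <= k)%N | Min => (k <= l)%N end.

(* [optimal_length p c m]: from [c] with [p] to move, exactly [m] more chips
   are placed under optimal play (backward induction). In [OptMove], [f w] is
   the optimal number of further chips after [p] plays on [w], and [v] is a
   best move for [p]. *)
Inductive optimal_length : player -> config -> nat -> Prop :=
| OptEnd p c : volatile c -> optimal_length p c 0
| OptMove p c (f : G -> nat) v :
    ~ volatile c ->
    (forall w, optimal_length (opponent p) (place c w) (f w)) ->
    (forall w, prefers p (f v) (f w)) ->
    optimal_length p c (f v).+1.

(* [toppling_lengthP] below shows that, unless [G] has no vertices, the default
   value 0 of [xget] is not used. *)
Definition toppling_length : nat :=
  xget 0 [set m | optimal_length Max empty_config m]%classic.

Lemma optimal_length_unique p c m m' :
  optimal_length p c m -> optimal_length p c m' -> m = m'.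
Proof.
move=> H; elim: H m' => {p c m} [p c vc|p c f v nv _ IH best] m' H'.
  by inversion H'.
inversion H' as [|p' c' f' v' nv' Hf' best']; subst => //.
have eqf w : f w = f' w by apply: IH; exact: Hf'.
have := best v'; have := best' v; rewrite -!eqf => b1 b2.
congr _.+1; apply/eqP; rewrite eqn_leq.
by case: p {IH nv H' Hf' best best'} b1 b2 => /= -> ->.
Qed.

Let total c := (\sum_v c v)%N.
Let vol := (\sum_(v : G) degree v)%N.

Let total_fire c v : may_fire c v -> total (fire c v) = total c.
Proof.
move=> h; rewrite /total.
have sdeg : (\sum_w (adj v w : nat))%N = degree v.
  rewrite /degree -sum1_card [RHS]big_mkcond /=; apply: eq_bigr => w _.
  by rewrite inE; case: (adj v w).
under eq_bigr do rewrite ffunE.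
rewrite big_split /= sdeg (bigD1 v) //= eqxx [in RHS](bigD1 v) //=.
under eq_bigr => w /negbTE -> do rewrite subn0.
by rewrite addnAC subnK.
Qed.

Let volatile_of_total c : (0 < #|G|)%N -> (vol <= total c)%N -> volatile c.
Proof.
move=> /card_gt0P[v0 _] h.
have ex c' : total c' = total c -> exists v, may_fire c' v.
  move=> e; apply/existsP; apply: contraT; rewrite negb_exists => /forallP nf.
  suff : (total c' < vol)%N by rewrite e ltnNge h.
  rewrite /total /vol (bigD1 v0) //= [ltnRHS](bigD1 v0) //=.
  rewrite -addSn leq_add //; first by rewrite ltnNge nf.
  by apply: leq_sum => w _; rewrite ltnW // ltnNge nf.
pose pk c' := odflt v0 [pick v | may_fire c' v].
have pkP c' : total c' = total c -> may_fire c' (pk c').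
  move=> /ex[v hv]; rewrite /pk; case: pickP => //= nf.
  by rewrite nf in hv.
pose st i := iter i (fun c' => fire c' (pk c')) c.
pose s i := pk (st i).
have stE i : foldl fire c (mkseq s i) = st i.
  by elim: i => // i IH; rewrite /mkseq -addn1 iotaD map_cat foldl_cat /= [foldl _ _ _]IH add0n addn1.
have tst i : total (st i) = total c.
  by elim: i => // i IH; rewrite /st iterS -/(st i) total_fire ?IH // pkP.
by exists s => i; rewrite stE; exact: pkP.
Qed.

Lemma optimal_length_exists p c :
  (0 < #|G|)%N -> exists m, optimal_length p c m.
Proof.
move=> G0; have [k] := ubnP (vol - total c); elim: k p c => // k IH p c hk.
have [vc|nv] := pselect (volatile c); first by exists 0%N; exact: OptEnd.
have lt : (total c < vol)%N.
  by rewrite ltnNge; apply/negP => /(volatile_of_total G0).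
have tp w : total (place c w) = (total c).+1.
  rewrite /total; under eq_bigr do rewrite ffunE.
  rewrite big_split /= -addn1; congr addn.
  by rewrite (bigD1 w) //= eqxx big1 // => u /negbTE ->.
have /choice[f Hf] : forall w, exists m, optimal_length (opponent p) (place c w) m.
  by move=> w; apply: IH; rewrite tp subnS prednK ?subn_gt0 //.
case/card_gt0P: G0 => v0 _.
have [v best] : exists v, forall w, prefers p (f v) (f w).
  case: p {IH Hf} => /=.
    by case: (@arg_maxnP _ v0 xpredT f) => // v _ b; exists v => w; exact: b.
  by case: (@arg_minnP _ v0 xpredT f) => // v _ b; exists v => w; exact: b.
by exists (f v).+1; exact: OptMove.
Qed.

Lemma toppling_lengthP :
  (0 < #|G|)%N -> optimal_length Max empty_config toppling_length.
Proof.
move=> /(optimal_length_exists Max empty_config)[m hm].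
by rewrite /toppling_length; case: xgetP => [x _ //|/(_ m)].
Qed.

End TopplingGame.

Local Open Scope classical_set_scope.
Local Open Scope ring_scope.

(* The system is singular at [z = 0], so it is required for [0 < x] and the
   initial values are attained by continuity. It also has a solution with
   [z < 0], along which [y + z] decreases; the last clause excludes it. *)
Definition toppling_ode (R : realType) (y z : R -> R) : Prop :=
  [/\ y 0 = 0 /\ z 0 = 0,
      {within `[0, +oo[, continuous y} /\ {within `[0, +oo[, continuous z},
      forall x : R, 0 < x -> z x <> 0 /\ z x <> 1,
      forall x : R, 0 < x ->
        is_derive x 1 y (1 / (1 - z x)) /\
        is_derive x 1 z (1 / z x - 1 / (1 - z x)) &
      forall a b : R, 0 <= a -> a < b -> y a + z a < y b + z b].

(* Main.v *)
Require Import Defs.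
From mathcomp Require Import all_boot all_order all_algebra.
From mathcomp Require Import all_classical all_reals all_analysis.
From mathcomp Require Import zify ring lra.
Import Order.TTheory GRing.Theory Num.Theory numFieldNormedType.Exports.
Local Open Scope classical_set_scope.
Local Open Scope ring_scope.

(* Let N(h) be the number of vertices of K_n holding at least h chips. A
   configuration is volatile as soon as N(h) >= n - h for all h: some vertex can
   fire, and firing preserves the condition. Min therefore raises the largest L
   with N(h) >= L - h for all h, by playing on a tight level, one where
   N(h) = L - h. Neither Max's moves nor firings lower L or create tight levels,
   so raising L by one costs at most k rounds, k being the number of tight levels
   when L is first reached. In a stable configuration N(h) + h - L, read
   cyclically in h, grows by at most one per step, so k zeros limit its sum: after
   t chips, 2t + n(n+1) <= 2nL + (n-k)(n-k+1). Rescaled by z = k/n, this is the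
   relation l - t = z - z^2/2 that holds along the solution of the system for
   l = y + z and t = 2x, where dt/dl = 2z is exactly Min's rate. Hence the game
   is over after at most 2 n^2 x_+ + O(n) chips.
   The system has the first integrals y + z^2/2 = 2x and
   (1 - 2z) e^(4y + 2z) = 1, so u = 1 - 2z(x_+) satisfies u e^(3 + u) = 1 and
   2 x_+ = 1/2 + (1 + u)^2 / 8. *)

Set Implicit Arguments.
Unset Strict Implicit.

(** * Firing sequences and stabilization *)

Section Reachability.
Local Open Scope nat_scope.
Variable G : sgraph.
Implicit Types (c : config G) (v w : G).

Inductive reach : config G -> config G -> Prop :=
| reach_refl c : reach c c
| reach_fire c v c' : may_fire c v -> reach (fire c v) c' -> reach c c'.

Lemma reach_trans c1 c2 c3 : reach c1 c2 -> reach c2 c3 -> reach c1 c3.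
Proof. by move=> r; elim: r => // c v c' cv _ IH /IH; exact: reach_fire. Qed.

Lemma volatile_fire c v : may_fire c v -> volatile (fire c v) -> volatile c.
Proof.
move=> cv [s hs]; exists (fun i => if i is j.+1 then s j else v) => -[//|i].
by rewrite /mkseq /= (iotaDl 1 0) -map_comp; exact: hs.
Qed.

Lemma volatile_reach c c' : reach c c' -> volatile c' -> volatile c.
Proof. by elim=> // {}c v {}c' cv _ IH /IH; exact: volatile_fire. Qed.

Lemma fire_place c v w :
  may_fire c v -> fire (place c w) v = place (fire c v) w.
Proof.
move=> cv; apply/ffunP => u; rewrite !ffunE.
by case: (eqVneq u v) => [->|_]; move: cv; rewrite /may_fire; lia.
Qed.

(** Placing a chip commutes with a legal firing, so the game can be followed on stabilized
    configurations. *)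
Lemma reach_place c c' w : reach c c' -> reach (place c w) (place c' w).
Proof.
elim=> {c c'} [c|c v c' cv _ IH]; first exact: reach_refl.
apply: (@reach_fire _ v); last by rewrite fire_place.
by apply: (leq_trans cv); rewrite ffunE leq_addr.
Qed.

Definition stable c := forall v, ~~ may_fire c v.

Lemma volatile_invariant (Q : config G -> Prop) c :
  Q c -> (forall c', Q c' -> exists2 v, may_fire c' v & Q (fire c' v)) ->
  volatile c.
Proof.
move=> Qc step.
have [v0 _ _] := step _ Qc.
have /choice[pk pkP] : forall c', exists v, Q c' -> may_fire c' v /\ Q (fire c' v).
  move=> c'; have [/step[v cv Qv]|nQ] := pselect (Q c'); first by exists v.
  by exists v0.
pose st i := iter i (fun c' => fire c' (pk c')) c.
have stQ i : Q (st i) by elim: i => // i IH; exact: (pkP _ IH).2.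
exists (pk \o st) => i.
suff -> : foldl (@fire G) c (mkseq (pk \o st) i) = st i by exact: (pkP _ (stQ i)).1.
elim: i => // i IH.
by rewrite /mkseq -addn1 iotaD map_cat foldl_cat /= [foldl _ _ _]IH add0n addn1.
Qed.

(** If nothing reachable from [c] were stable, reachability from [c] would be an invariant that
    always allows a firing. *)
Lemma stabilization c : ~ volatile c -> exists2 c', reach c c' & stable c'.
Proof.
move=> nv; apply: contrapT => H; apply: nv.
apply: (@volatile_invariant (reach c)); first exact: reach_refl.
move=> c' rc'; have [/forallP st|] := boolP [forall v, ~~ may_fire c' v].
  by case: H; exists c'.
rewrite negb_forall => /existsP[v]; rewrite negbK => cv; exists v => //.
by apply: reach_trans rc' _; exact: reach_fire cv (reach_refl _).
Qed.

End Reachability.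

(** * Sums of sequences that grow by at most one per step *)

Section CyclicSum.
Local Open Scope nat_scope.

(** A nonzero term is at most [p.+1], with [p] counted before it; it raises [p] by one and
    [p * p.+1] by [2 * p.+1]. A zero term leaves both sides of the inequality unchanged. *)
Lemma sum_slow_growth (f : nat -> nat) a b m :
  (forall i, a <= i < b -> f i.+1 <= (f i).+1) -> a <= b -> f a <= m.+1 ->
  let p := m + \sum_(a <= i < b) (f i != 0) in
  (\sum_(a <= i < b) f i).*2 + m * m.+1 <= p * p.+1 /\ f b <= p.+1.
Proof.
move=> + leab; elim: b leab => [|b IH] leab fS fa /=.
  by move: leab fa; rewrite leqn0 => /eqP -> fa; rewrite !big_geq // addn0.
move: leab; rewrite leq_eqVlt => /predU1P[<-|ltab].
  by rewrite !big_geq // addn0.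
have leab : a <= b by [].
have fS' i : a <= i < b -> f i.+1 <= (f i).+1.
  by move=> /andP[ai ib]; apply: fS; rewrite ai ltnW.
have [] := IH leab fS' fa.
rewrite !big_nat_recr //=.
have := fS b; rewrite leab ltnSn => /(_ isT).
set S := \sum_(_ <= _ < _) f _; set M := \sum_(_ <= _ < _) (_ != _).
by case: (f b) => [|x] /=; nia.
Qed.

(* Among cyclic sequences with [k] zeros that grow by at most one per step,
   the sum is largest when the nonzero terms form a single run [1, 2, ..., n - k]. *)
Lemma sum_cyclic_slow_growth (f : nat -> nat) n h :
  (forall i, i < n -> f i.+1 <= (f i).+1) -> f n = f 0 -> h < n -> f h = 0 ->
  let p := \sum_(0 <= i < n) (f i != 0) in
  (\sum_(0 <= i < n) f i).*2 <= p * p.+1.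
Proof.
move=> fS fn hn fh /=.
have fS1 i : h <= i < n -> f i.+1 <= (f i).+1 by move=> /andP[_]; exact: fS.
have fS2 i : 0 <= i < h -> f i.+1 <= (f i).+1.
  by move=> /andP[_ ih]; apply: fS; exact: ltn_trans hn.
have fh1 : f h <= 1 by rewrite fh.
(* The cycle is cut at the zero [h]: the terms from [h] to [n] come first, and their nonzero count
   is the [m] for those before [h]. *)
have [] := sum_slow_growth fS1 (ltnW hn) fh1.
rewrite add0n fn => S1 f0.
have [S2 _] := sum_slow_growth fS2 (leq0n h) f0.
rewrite !(@big_cat_nat _ _ _ h 0 n) //= ?(ltnW hn) //.
set A := \sum_(0 <= _ < h) f _ in S2 *; set B := \sum_(h <= _ < n) f _ in S1 *.
rewrite doubleD [X in _ <= X * X.+1]addnC; lia.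
Qed.
End CyclicSum.

(** * Levels and tight steps on the complete graph, and Min's strategy *)

Section CompleteGraph.
Local Open Scope nat_scope.
Variable n : nat.
Local Notation K := (complete_graph n).
Implicit Types (c : config K) (v w : K).

Lemma degree_complete v : degree v = n.-1.
Proof.
rewrite /degree -[in RHS](card_ord n) -(cardC1 (v : 'I_n)).
by apply: eq_card => u; rewrite !inE eq_sym.
Qed.

Definition chips c := \sum_v c v.

Definition num_ge c h := \sum_v (h <= c v).

(* The stacks sorted in decreasing order dominate the staircase
   [L - 1, L - 2, ...]. *)
Definition above c L := forall h, L <= num_ge c h + h.

(* Counts the steps of that staircase which are met exactly, i.e. the chips that
   are needed to make [above c L.+1] hold. *)
Definition tight c L := \sum_(0 <= h < n) (num_ge c h + h <= L).

Lemma num_ge0 c : num_ge c 0 = n.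
Proof. by rewrite /num_ge sum1_card card_ord. Qed.

Lemma num_geS c h : num_ge c h.+1 <= num_ge c h.
Proof. by apply: leq_sum => v _; case: (ltnP h (c v)) => // /ltnW ->. Qed.

Lemma chips_place c v : chips (place c v) = (chips c).+1.
Proof.
rewrite /chips; under eq_bigr do rewrite ffunE.
rewrite big_split /= -addn1; congr addn.
by rewrite (bigD1 v) //= eqxx big1 // => u /negbTE ->.
Qed.

Lemma num_ge_place c v h : num_ge (place c v) h = num_ge c h + (h == (c v).+1).
Proof.
rewrite /num_ge (bigD1 v) //= [in RHS](bigD1 v) //= ffunE eqxx.
under eq_bigr => w /negbTE wv do rewrite ffunE wv addn0.
rewrite addn1 addnAC; congr addn.
by rewrite leq_eqVlt ltnS addnC; case: eqP => // ->; rewrite ltnn.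
Qed.

Lemma above_place c v L : above c L -> above (place c v) L.
Proof. by move=> cL h; rewrite num_ge_place; have := cL h; lia. Qed.

Lemma tight_place c v L : tight (place c v) L <= tight c L.
Proof.
by apply: leq_sum => h _; rewrite num_ge_place; lia.
Qed.

(** A tight [h] is positive since [L < n], and some vertex holds exactly [h.-1] chips: otherwise
    [num_ge] would agree at [h.-1] and [h], violating [above] at [h.-1]. A chip on that vertex lifts
    [num_ge] at [h]. *)
Lemma tight_place_lt c L :
  L < n -> above c L -> 0 < tight c L ->
  exists v, tight (place c v) L < tight c L.
Proof.
move=> Ln cL; rewrite /tight big_mkord => /[dup] + tc.
rewrite lt0n sum_nat_eq0 negb_forall => /existsP[[h hn]] /=.
rewrite eqb0 negbK => hL.
have h0 : 0 < h.
  by rewrite lt0n; apply: contraL hL => /eqP ->; rewrite num_ge0; lia.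
have [v hv] : exists v, (c v).+1 = h.
  apply: contrapT => H.
  suff : num_ge c h.-1 <= num_ge c h by have := cL h.-1; lia.
  by apply: leq_sum => v _; have : (c v).+1 <> h by [move=> ?; apply: H; exists v]; lia.
exists v; rewrite big_mkord (bigD1 (Ordinal hn)) //= [ltnRHS](bigD1 (Ordinal hn)) //=.
rewrite num_ge_place hv eqxx hL -addSn leq_add //; last first.
  by apply: leq_sum => i _; rewrite num_ge_place; lia.
by have := cL h; lia.
Qed.

Lemma chips_fire c v : may_fire c v -> chips (fire c v) = chips c.
Proof.
move=> cv; rewrite /chips (bigD1 v) //= [in RHS](bigD1 v) //= ffunE /= eqxx /=.
under eq_bigr => w wv do rewrite ffunE /= (negbTE wv) subn0 eq_sym wv.
rewrite big_split /= sum1_card cardC1 card_ord.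
by rewrite addn0 addnCA [LHS]addnC degree_complete subnK // -(degree_complete v).
Qed.

(** Every vertex except [v] gains a chip, so at most one stack is lost when the height is shifted up
    by one. *)
Lemma num_ge_fireS c v h : num_ge c h <= (num_ge (fire c v) h.+1).+1.
Proof.
rewrite /num_ge (bigD1 v) //= [in leqRHS](bigD1 v) //=.
rewrite -addSn; apply: leq_add; first lia.
by apply: leq_sum => w wv; rewrite ffunE /= (negbTE wv) eq_sym wv; lia.
Qed.

Lemma above_fire c v L : L <= n -> above c L -> above (fire c v) L.
Proof.
move=> Ln cL [|h]; first by rewrite num_ge0 addn0.
by have := num_ge_fireS c v h; have := cL h; lia.
Qed.

(** A step [h.+1] tight after the firing comes from a step [h] tight before it; step 0 is not tight
    because [L < n]. *)
Lemma tight_fire c v L : L < n -> tight (fire c v) L <= tight c L.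
Proof.
move=> Ln; suff H m : \sum_(0 <= h < m.+1) (num_ge (fire c v) h + h <= L) <=
                    \sum_(0 <= h < m.+1) (num_ge c h + h <= L).
  by rewrite /tight; have := H n.-1; rewrite prednK // (leq_ltn_trans _ Ln).
rewrite big_nat_recl // num_ge0 addn0 (leqNgt n) Ln add0n big_nat_recr //=.
apply: leq_trans (leq_addr _ _); apply: leq_sum => h _.
by have := num_ge_fireS c v h; lia.
Qed.

Lemma reach_invariants c c' L :
  reach c c' -> L < n -> above c L ->
  [/\ chips c' = chips c, above c' L & tight c' L <= tight c L].
Proof.
move=> r Ln; elim: r => // {}c v {}c' cv _ IH cL.
have [-> ? le] := IH (above_fire v (ltnW Ln) cL).
by rewrite chips_fire //; split=> //; exact: leq_trans le (tight_fire _ _ Ln).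
Qed.

Lemma above_volatile c : 1 < n -> above c n -> volatile c.
Proof.
move=> n1 cn; apply: (@volatile_invariant _ (above ^~ n)) => // {cn}c cn.
have [v cv] : exists v, may_fire c v.
  apply: contrapT => H; suff : num_ge c n.-1 = 0 by have := cn n.-1; lia.
  rewrite /num_ge big1 // => v _; apply/eqP; rewrite eqb0.
  by apply/negP => cv; apply: H; exists v; rewrite /may_fire degree_complete.
by exists v => //; exact: above_fire.
Qed.

(** After exchanging the sums, [v] is counted at the heights from 0 to [c v], all below [n]. *)
Lemma sum_num_ge c :
  (forall v, c v < n) -> \sum_(0 <= h < n) num_ge c h = chips c + n.
Proof.
move=> cn; rewrite /num_ge exchange_big /= -[X in _ + X](num_ge0 c) -big_split /=.
apply: eq_bigr => v _; have vn := cn v.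
rewrite (@big_cat_nat _ _ _ (c v).+1) //= big_nat (eq_bigr (fun=> 1)); last first.
  by move=> h /andP[_]; rewrite ltnS => ->.
rewrite -big_nat sum_nat_const_nat subn0 muln1 big_nat big1 ?addn0 ?addn1 //.
by move=> h /andP[vh _]; rewrite leqNgt vh.
Qed.

(** The cyclic bound applies to [f h = num_ge c h + h - L], whose zeros are the tight steps: it
    grows slowly because [num_ge] is nonincreasing, and closes up because stability gives
    [num_ge c n = 0]. *)
Lemma chips_le_tight c L :
  stable c -> L < n -> above c L -> 0 < tight c L ->
  (chips c).*2 + n * n.+1 <= (n * L).*2 + (n - tight c L) * (n - tight c L).+1.
Proof.
move=> st Ln cL; have cn v : c v < n.
  by have := st v; rewrite /may_fire degree_complete; lia.
pose f h := num_ge c h + h - L.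
have count_le : \sum_(0 <= h < n) (f h != 0) <= n.
  rewrite -[leqRHS]muln1 -[X in X * _](subn0 n) -sum_nat_const_nat.
  by apply: leq_sum => h _; exact: leq_b1.
have fE h : f h = 0 <-> num_ge c h + h <= L by rewrite /f; lia.
have -> : tight c L = n - \sum_(0 <= h < n) (f h != 0).
  apply/eqP; rewrite -(eqn_add2r (\sum_(0 <= h < n) (f h != 0))) subnK //.
  rewrite -big_split /= -[eqbRHS]muln1 -[X in _ == X * _](subn0 n) -sum_nat_const_nat.
  apply/eqP/eq_bigr => h _.
  by have := fE h; case: (f h) => [[->]//|x [_ H]]; case: leqP => // /H.
rewrite subKn // => t0.
have [h hn fh] : exists2 h, h < n & f h = 0.
  apply: contrapT => H; move: t0; rewrite big_nat (eq_bigr (fun=> 1)); last first.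
    by move=> h hn; case: eqP => // fh; case: H; exists h.
  by rewrite -big_nat sum_nat_const_nat subn0 muln1 subnn.
have fS i : i < n -> f i.+1 <= (f i).+1.
  by move=> _; rewrite /f; have := num_geS c i; have := cL i.+1; lia.
have fn : f n = f 0.
  rewrite /f num_ge0 addn0 /num_ge big1 // => v _; apply/eqP; rewrite eqb0 -ltnNge; exact: cn.
have /= := sum_cyclic_slow_growth fS fn hn fh.
suff : (\sum_(0 <= h < n) f h).*2 + (n * L).*2 = (chips c).*2 + n * n.+1 by lia.
have -> : n * L = \sum_(0 <= h < n) L by rewrite sum_nat_const_nat subn0.
rewrite -doubleD -big_split /=.
under eq_bigr => i _ do rewrite (subnK (cL i)).
rewrite big_split /= sum_num_ge //.
have : (\sum_(0 <= h < n) h).*2 + n = n * n.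
  by elim: (n) => [|m IH]; rewrite ?big_nil ?big_nat_recr //=; lia.
by set S := \sum_(_ <= _ < _) _; lia.
Qed.

(** If level [L] is reached with [t <= B L] chips and [k] tight steps, clearing these at one round
    of two chips each stays within [B L.+1]. The quadratic premise is what [chips_le_tight]
    supplies. *)
Definition staircase_budget (R : realType) (B : nat -> R) :=
  forall L k t, L < n -> 0 < k <= n ->
    t.*2 + n * n.+1 <= (n * L).*2 + (n - k) * (n - k).+1 ->
    (t%:R <= B L -> (t + k.*2)%:R <= B L.+1)%R.

(* After a full round in which Min plays on a tight step, [t + 2 k] does not
   increase: two chips are added and one tight step disappears. *)
Lemma optimal_length_le (R : realType) (B : nat -> R) m c c' L :
  1 < n -> {homo B : i j / i <= j >-> (i <= j)%R} -> staircase_budget B ->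
  optimal_length Max c m -> reach c c' -> above c' L -> L < n ->
  ((chips c' + (tight c' L).*2)%:R <= B L.+1)%R ->
  ((chips c' + m)%:R <= B n)%R.
Proof.
(* Each round adds two chips and a stable configuration holds fewer than [n * n], so the induction
   is on the difference. *)
move=> n1 Bmono budget; have [d] := ubnP (n * n - chips c').
elim: d m c c' L => // d IHd m c c' L nc' opt r cL Ln le.
have [vc|nvc] := pselect (volatile c).
  rewrite (optimal_length_unique opt (OptEnd _ vc)) addn0.
  by apply: le_trans (Bmono _ _ Ln); apply: le_trans le; rewrite ler_nat leq_addr.
have [c1 r1 st1] : exists2 c1, reach c' c1 & stable c1.
  by apply: stabilization => /(volatile_reach r).
have [ch1 cL1 t1] := reach_invariants r1 Ln cL.
have rc1 := reach_trans r r1.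
have {le}le1 : ((chips c1 + (tight c1 L).*2)%:R <= B L.+1)%R.
  by apply: le_trans le; rewrite ler_nat ch1 leq_add2l leq_double.
rewrite -{}ch1 in nc' *; move: {c' r r1 cL t1} c1 nc' rc1 st1 cL1 le1 => c' nc' r st cL le.
(* The level is raised until it has a tight step; this stops before [n], where the configuration
   would be volatile. *)
have [M MP] : exists M, [/\ M < n, above c' M, 0 < tight c' M
    & ((chips c' + (tight c' M).*2)%:R <= B M.+1)%R].
  have [e] := ubnP (n - L); elim: e L Ln cL le => // e IHe L Ln cL le eL.
  have [t0|t0] := posnP (tight c' L); last by exists L.
  have cL1 : above c' L.+1.
    move=> h; rewrite ltnNge; apply/negP => hL.
    have hn : h < n.
      exact: leq_ltn_trans (leq_addl _ _) (leq_ltn_trans hL Ln).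
    move: t0; rewrite /tight big_mkord (bigD1 (Ordinal hn)) //= hL; lia.
  have L1n : L.+1 < n.
    rewrite ltn_neqAle Ln andbT; apply/eqP => Ln1; apply: nvc; apply: volatile_reach r _.
    by apply: above_volatile => //; rewrite -Ln1.
  have [t1|t1] := posnP (tight c' L.+1).
    apply: (IHe L.+1) => //; last lia.
    by apply: le_trans (Bmono _ _ (leqnSn _)); apply: le_trans le; rewrite ler_nat t1 leq_add2l.
  exists L.+1; split => //; apply: budget => //.
  - rewrite t1 /=; apply: leq_trans (_ : \sum_(0 <= h < n) 1 <= _).
      by apply: leq_sum => h _; exact: leq_b1.
    by rewrite sum_nat_const_nat subn0 muln1.
  - exact: chips_le_tight.
  - by apply: le_trans le; rewrite ler_nat leq_addr.
move: MP {L Ln cL le} => [Mn cM tM le].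
have n2 : ((chips c' + 2)%:R <= B n)%R.
  apply: le_trans (Bmono _ _ Mn); apply: le_trans le.
  by rewrite ler_nat leq_add2l; move: tM; lia.
inversion opt as [|p0 c0 f v _ optMin best ep ec em]; subst => //.
have rv := reach_place v r.
have [vv|nvv] := pselect (volatile (place c v)).
  rewrite (optimal_length_unique (optMin v) (OptEnd _ vv)).
  by apply: le_trans n2; rewrite ler_nat leq_add2l.
(* Min's reply: a chip on a tight step, or anywhere if Max has just removed the last one. *)
have [w tw] : exists w, (tight (place (place c' v) w) M).+1 <= tight c' M.
  have [t0|t0] := posnP (tight (place c' v) M).
    by exists v; apply: leq_ltn_trans tM; rewrite -t0; exact: tight_place.
  have [w wP] := tight_place_lt Mn (above_place v cM) t0.
  by exists w; apply: leq_trans wP _; exact: tight_place.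
have cc' : chips c' < n * n.
  have -> : n * n = \sum_(u : K) n by rewrite sum_nat_const card_ord.
  have cn (u : K) : c' u < n by have := st u; rewrite /may_fire degree_complete; lia.
  rewrite /chips (bigD1 v) //= [ltnRHS](bigD1 v) //= -addSn.
  by apply: (leq_add (cn v)); apply: leq_sum => u _; exact: ltnW (cn u).
have := optMin v => /= optv.
inversion optv as [|p1 c1 g w0 _ optMax bestg ep1 ec1 em1]; subst => //.
have := IHd (g w) _ _ M _ (optMax w) (reach_place w rv) (above_place w (above_place v cM)) Mn.
rewrite !chips_place => IH; apply: le_trans (IH _ _).
- by rewrite ler_nat; have := bestg w => /=; lia.
- by move: nc' cc'; set N := (n * n)%N; set x := chips c'; clearbody N x; clear; lia.
- by apply: le_trans le; rewrite ler_nat; lia.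
Qed.

Lemma toppling_length_le (R : realType) (B : nat -> R) :
  1 < n -> {homo B : i j / i <= j >-> (i <= j)%R} -> (0 <= B 1)%R ->
  staircase_budget B -> ((toppling_length K)%:R <= B n)%R.
Proof.
move=> n1 Bmono B1 budget.
have opt : optimal_length Max (empty_config K) (toppling_length K).
  by apply: toppling_lengthP; rewrite card_ord ltnW.
have c0 : chips (empty_config K) = 0 by rewrite /chips big1 // => v _; rewrite ffunE.
have t0 : tight (empty_config K) 0 = 0.
  rewrite /tight big_nat big1 // => -[|h] _; last by rewrite addnS.
  by rewrite num_ge0 addn0 leqn0; case: (n) n1.
have := optimal_length_le n1 Bmono budget opt (reach_refl _) (_ : above _ 0) (ltnW n1).
by rewrite c0 t0 !add0n; apply.
Qed.
End CompleteGraph.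

Lemma card_edges_complete n : #|edges (complete_graph n)| = 'C(n, 2).
Proof.
rewrite -[in RHS](card_ord n) -card_draws; apply: eq_card => A; rewrite !inE.
apply/existsP/cards2P => [[u /existsP[v /andP[uv /eqP ->]]]|[u [v [uv ->]]]].
  by exists u, v.
by exists u; apply/existsP; exists v; rewrite /= uv eqxx.
Qed.

(** * Numerical bound on the final time *)

Section ExpBounds.
Variable R : realType.

Lemma expR_ge_partial_sum (x : R) n :
  0 <= x -> \sum_(0 <= i < n) x ^+ i / i`!%:R <= expR x.
Proof.
move=> x0; apply: (@nondecreasing_cvgn_le _ (series (exp_coeff x))).
  apply/nondecreasing_seqP => m; rewrite /series /= big_nat_recr //= lerDl.
  exact: exp_coeff_ge0.
exact: is_cvg_series_exp_coeff.
Qed.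

(* The root [u] of [u e^(3 + u) = 1] is below [0.04748], since
   [e >= 2.71828] and [e^v >= 1 + v + v^2 / 2] make the left side exceed 1 there. *)
Lemma final_time_bound (z x : R) :
  (1 - 2 * z) * expR (4 - 2 * z) = 1 -> 2 * x = 1 - z + z ^+ 2 / 2 ->
  2 * x < (637 * 10 ^+ 3 + 152) / 10 ^+ 6.
Proof.
move=> E ->.
pose u := 1 - 2 * z.
have [v vE] : exists v : R, v = (47 + 48 / 10 ^+ 2) / 10 ^+ 3 by eexists.
have zE : z = (1 - u) / 2 by rewrite /u; field.
have [uv|uv] := leP v u; last first.
  have u0 : 0 < u by rewrite -(pmulr_lgt0 _ (expR_gt0 (4 - 2 * z))) E.
  (* The quantity to bound is [1/2 + (1 + u)^2 / 8], and [v] in place of [u] already keeps it below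
     the constant. *)
  suff : (1 + u) ^+ 2 < (1 + v) ^+ 2 by rewrite zE vE => ?; lra.
  by rewrite ltrXn2r // ?nnegrE; lra.
have v0 : 0 <= v by lra.
have [q qE] : exists q : R, q = (271 + 828 / 10 ^+ 3) / 10 ^+ 2 by eexists.
have q0 : 0 <= q by lra.
have e1 : q <= expR 1.
  apply: le_trans (expR_ge_partial_sum 10 ler01).
  rewrite !big_nat_recr //= big_geq //= !expr1n !factS fact0 !natrM.
  lra.
have [p pE] : exists p : R, p = 1 + v + v ^+ 2 / 2 by eexists.
have p0 : 0 <= p by rewrite pE; nra.
have e2 : p <= expR v.
  apply: le_trans (expR_ge_partial_sum 3 v0).
  by rewrite !big_nat_recr //= big_geq //= !factS fact0 !natrM expr0 expr1; lra.
have e3 : q ^+ 3 * p <= expR (3 + v).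
  rewrite expRD -[X in expR X * _]mulr1 expRM_natl; apply: ler_pM.
  - exact: exprn_ge0.
  - exact: p0.
  - by apply: lerXn2r; rewrite ?nnegrE ?expR_ge0.
  - exact: e2.
suff : 1 < u * expR (3 + u).
  by rewrite (_ : 3 + u = 4 - 2 * z) ?E ?ltxx // /u; ring.
apply: lt_le_trans (_ : v * expR (3 + v) <= _); last first.
  by apply: ler_pM; [exact: v0 | exact: expR_ge0 | exact: uv | rewrite ler_expR lerD2l].
apply: lt_le_trans (_ : v * (q ^+ 3 * p) <= _).
  by rewrite pE qE vE; lra.
exact: ler_wpM2l.
Qed.
End ExpBounds.

(** * First integrals and monotonicity of the solution *)

Section TopplingODE.
Variables (R : realType) (y z : R -> R).
Hypothesis yz : toppling_ode y z.

Let cy : {within `[0, +oo[, continuous y}. Proof. by case: yz => _ []. Qed.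
Let cz : {within `[0, +oo[, continuous z}. Proof. by case: yz => _ []. Qed.
Let y0 : y 0 = 0. Proof. by case: yz => -[]. Qed.
Let z0 : z 0 = 0. Proof. by case: yz => -[]. Qed.
Let dy (x : R) : 0 < x -> is_derive x 1 y (1 / (1 - z x)).
Proof. by case: yz => _ _ _ + _ => /[apply] -[]. Qed.
Let dz (x : R) : 0 < x -> is_derive x 1 z (1 / z x - 1 / (1 - z x)).
Proof. by case: yz => _ _ _ + _ => /[apply] -[]. Qed.
Let z_neq0 (x : R) : 0 < x -> z x != 0.
Proof. by case: yz => _ _ + _ _ => /[apply] -[/eqP]. Qed.
Let subz_neq0 (x : R) : 0 < x -> 1 - z x != 0.
Proof. by case: yz => _ _ + _ _ => /[apply] -[_ /eqP]; rewrite subr_eq0 eq_sym. Qed.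

(** Derivatives are asked for at positive arguments only, since the system is singular at 0. *)
Lemma MVT_ray (f df : R -> R) a b :
  {within `[0, +oo[, continuous f} -> (forall x : R, 0 < x -> is_derive x 1 f (df x)) ->
  0 <= a -> a < b -> exists2 c, a < c < b & f b - f a = df c * (b - a).
Proof.
move=> cf fdf a0 ab; have [||c + ->] := @MVT _ f df a b ab.
- by move=> x; rewrite in_itv /= => /andP[/(le_lt_trans a0)/fdf].
- apply: continuous_subspaceW cf => x; rewrite /= !in_itv /= andbT => /andP[ax _].
  exact: le_trans ax.
by rewrite in_itv; exists c.
Qed.

Lemma derive0_ray (f : R -> R) x :
  {within `[0, +oo[, continuous f} -> (forall x : R, 0 < x -> is_derive x 1 f 0) ->
  0 <= x -> f x = f 0.
Proof.
move=> cf df; rewrite le_eqVlt => /predU1P[<-//|x0].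
have [c _ /eqP] := @MVT_ray f (fun=> 0) 0 x cf df (lexx 0) x0.
by rewrite mul0r subr_eq0 => /eqP.
Qed.

Lemma ode_height_derive (x : R) : 0 < x -> is_derive x 1 (y + z) (1 / z x).
Proof.
move=> x0; have := dy x0; have := dz x0 => ? ?.
by apply: is_derive_eq; rewrite addrC subrK.
Qed.

Lemma ode_height_cont : {within `[0, +oo[, continuous (y + z)}.
Proof. by move=> x; apply: cvgD; [exact: cy | exact: cz]. Qed.

(** The increasing function [y + z] has derivative [1 / z], which is therefore nonnegative. *)
Lemma ode_z_gt0 (x : R) : 0 < x -> 0 < z x.
Proof.
move=> x0; rewrite lt_def z_neq0 //= -invr_ge0 -div1r.
have := ode_height_derive x0 => dx; rewrite -(@derive_val _ _ _ _ _ _ _ dx) -derive1E.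
apply: (@incr_derive1_ge0_itvy _ _ true 0).
- move=> t; rewrite inE /= in_itv /= andbT => t0.
  by have := ode_height_derive t0 => -[].
- move=> s t; rewrite !in_itv /= !andbT => s0 t0 st.
  by case: yz => _ _ _ _; apply.
- by rewrite in_itv /= x0.
Qed.

(** The left side has derivative [1 / (1 - z) + z (1 / z - 1 / (1 - z)) = 2]. *)
Lemma ode_chips x : 0 <= x -> y x + z x ^+ 2 / 2 = 2 * x.
Proof.
move=> x0; apply/eqP; rewrite -subr_eq0; apply/eqP.
pose f := y + 2^-1 *: (z * z) - 2 *: id.
have fE t : f t = y t + z t ^+ 2 / 2 - 2 * t.
  by rewrite /f !fctE /= /GRing.scale /=; field.
suff [cf df] : {within `[0, +oo[, continuous f} /\ forall t : R, 0 < t -> is_derive t 1 f 0.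
  by rewrite -fE (derive0_ray cf df x0) fE y0 z0 expr0n /=; ring.
split.
- have cid : {within `[0, +oo[, continuous (@id R)}.
    by apply: continuous_subspaceT => t; exact: cvg_id.
  move=> t; apply: cvgB; last by apply: cvgZl_tmp; exact: cid.
  apply: cvgD; first exact: cy.
  by apply: cvgZl_tmp; apply: cvgM; exact: cz.
move=> t t0; have dzt := dz t0.
have d := is_deriveB (is_deriveD (dy t0) (is_deriveZ 2^-1 (is_deriveM dzt dzt)))
            (is_deriveZ 2 (is_derive_id t 1)).
apply: (is_derive_eq d); rewrite /GRing.scale /=.
by field; rewrite z_neq0 // subz_neq0.
Qed.

(** The derivative is the exponential times [4 (1 - 2 z) y' - 4 z z'], and the system gives
    [z z' = (1 - 2 z) y']. *)
Lemma ode_first_integral x :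
  0 <= x -> (1 - 2 * z x) * expR (4 * y x + 2 * z x) = 1.
Proof.
move=> x0.
pose f := (cst 1 - 2 *: z) * (expR \o (4 *: y + 2 *: z)).
have fE t : f t = (1 - 2 * z t) * expR (4 * y t + 2 * z t) by [].
suff [cf df] : {within `[0, +oo[, continuous f} /\ forall t : R, 0 < t -> is_derive t 1 f 0.
  by rewrite -fE (derive0_ray cf df x0) fE y0 z0 !mulr0 addr0 subr0 expR0 mulr1.
split.
- move=> t; apply: cvgM.
    by apply: cvgB; [exact: cvg_cst | apply: cvgZl_tmp; exact: cz].
  have cg : (4 *: y + 2 *: z : subspace `[0, +oo[ -> R) @ t --> (4 *: y + 2 *: z) t.
    by apply: cvgD; apply: cvgZl_tmp; [exact: cy | exact: cz].
  by apply: cvg_comp cg _; exact: continuous_expR.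
move=> t t0; have dzt := dz t0.
have dc : is_derive t (1 : R) (cst (1 : R)) 0 by exact: is_derive_cst.
have d := is_deriveM (is_deriveB dc (is_deriveZ 2 dzt))
  (is_derive1_comp (is_derive_expR _)
    (is_deriveD (is_deriveZ 4 (dy t0)) (is_deriveZ 2 dzt))).
apply: (is_derive_eq d).
set e := expR (4 * y t + 2 * z t); transitivity ((1 - 2 * z t) *
  (e * (4 * (1 / (1 - z t)) + 2 * (1 / z t - 1 / (1 - z t)))) +
  e * (0 - 2 * (1 / z t - 1 / (1 - z t)))) => [//|].
by field; rewrite z_neq0 // subz_neq0.
Qed.

(** The exponential in the first integral is positive, so [1 - 2 z] is too. Then [z < 1 - z], which
    makes [z'] positive. *)
Lemma ode_z_lt_half x : 0 <= x -> z x < 1 / 2.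
Proof.
move=> x0; have : 0 < (1 - 2 * z x).
  by rewrite -(pmulr_lgt0 _ (expR_gt0 (4 * y x + 2 * z x))) ode_first_integral.
lra.
Qed.

Lemma ode_z_mono a b : 0 <= a -> a < b -> z a <= z b.
Proof.
move=> a0 ab; rewrite -subr_ge0.
have [c /andP[ac cb] ->] := MVT_ray cz dz a0 ab.
have c0 := le_lt_trans a0 ac.
rewrite mulr_ge0 ?subr_ge0 ?(ltW ab) // !div1r lef_pV2 ?posrE ?ode_z_gt0 //.
  by have := ode_z_lt_half (ltW c0); lra.
by have := ode_z_lt_half (ltW c0); lra.
Qed.

Variable xplus : R.
Hypotheses (xplus0 : 0 <= xplus) (yz1 : y xplus + z xplus = 1).

Lemma ode_final_time_bound : 2 * xplus < (637 * 10 ^+ 3 + 152) / 10 ^+ 6.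
Proof.
have yE : y xplus = 1 - z xplus by rewrite -yz1 addrK.
apply: (@final_time_bound _ (z xplus)).
  by rewrite -[RHS](ode_first_integral xplus0) yE; congr (_ * expR _); ring.
by rewrite -(ode_chips xplus0) yE.
Qed.

(* [X l] is the time at which [y + z] reaches [l], so that [X' = z] and [z] is
   nondecreasing. *)
Lemma ode_inverse_height : exists X : R -> R, [/\ X 1 = xplus, 0 <= X 0,
  forall l, 0 <= l <= 1 ->
    [/\ 0 <= z (X l) < 1 / 2 & 2 * X l = l - z (X l) + z (X l) ^+ 2 / 2] &
  forall l l', 0 <= l -> l < l' -> l' <= 1 -> (l' - l) * z (X l) <= X l' - X l].
Proof.
have s0 : y 0 + z 0 = 0 by rewrite y0 z0 addr0.
have smono a b : 0 <= a -> a < b -> y a + z a < y b + z b by case: yz => _ _ _ _; apply.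
have /choice[X XP] : forall l, exists x, 0 <= l <= 1 -> 0 <= x /\ y x + z x = l.
  move=> l; have [/andP[l0 l1]|//] := boolP (0 <= l <= 1); last by exists 0.
  have [||x] := @IVT _ (y + z) 0 xplus l xplus0.
  - apply: continuous_subspaceW ode_height_cont => x.
    by rewrite /= !in_itv /= andbT => /andP[].
  - by rewrite !fctE s0 yz1 minElt maxElt ltr01 l0.
  by rewrite in_itv /= => /andP[x0 _] <-; exists x.
exists X; split.
- have [X0 X1] := XP 1 ltac:(by rewrite ler01 lexx).
  have [lt|gt|//] := ltgtP (X 1) xplus.
    by have := smono _ _ X0 lt; rewrite X1 yz1 ltxx.
  by have := smono _ _ xplus0 gt; rewrite X1 yz1 ltxx.
- by have [] := XP 0 ltac:(by rewrite lexx ler01).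
- move=> l /XP[X0 Xl]; split; last first.
    have yE : y (X l) = l - z (X l) by apply/eqP; rewrite eq_sym subr_eq Xl.
    by rewrite -(ode_chips X0) yE.
  rewrite ode_z_lt_half // andbT; move: X0; rewrite le_eqVlt => /predU1P[<-|/ode_z_gt0/ltW//].
  by rewrite z0.
move=> l l' l0 ll' l'1.
have [X0 Xl] : 0 <= X l /\ y (X l) + z (X l) = l by apply: XP; lra.
have [X'0 Xl'] : 0 <= X l' /\ y (X l') + z (X l') = l' by apply: XP; lra.
have lt : X l < X l'.
  rewrite ltNge; apply/negP; rewrite le_eqVlt => /predU1P[e|/(smono _ _ X'0)]; last by lra.
  by move: ll'; rewrite -Xl -Xl' e ltxx.
(* Here [l' - l = (X l' - X l) / z c], and [z c >= z (X l)] by monotonicity. *)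
have [c /andP[Xc cX]] := MVT_ray ode_height_cont ode_height_derive X0 lt.
have c0 := le_lt_trans X0 Xc.
rewrite !fctE Xl Xl' => ->.
rewrite mulrAC ler_piMl ?subr_ge0 ?(ltW lt) //.
by rewrite mulrC mulrA mulr1 ler_pdivrMr ?ode_z_gt0 // mul1r ode_z_mono.
Qed.
End TopplingODE.

(** * The budget obtained from the differential equation *)

Section Budget.
Variables (R : realType) (X Z : R -> R) (n : nat).
Hypothesis n10 : (10 <= n)%N.
Hypothesis XZ : forall l, 0 <= l <= 1 ->
  [/\ 0 <= Z l < 1 / 2 & 2 * X l = l - Z l + Z l ^+ 2 / 2].
Hypothesis X_step : forall l l', 0 <= l -> l < l' -> l' <= 1 ->
  (l' - l) * Z l <= X l' - X l.

(* The linear term absorbs the rounding error of one chip per step. *)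
Definition ode_budget (L : nat) : R :=
  2 * n%:R ^+ 2 * X ((minn L n)%:R / n%:R) + 2 * L%:R.

Let n0 : 0 < n%:R :> R. Proof. by rewrite ltr0n; lia. Qed.

(** This is [X_step] over a step of length [1 / n], scaled by [n^2]. *)
Lemma ode_budget_step L : (L < n)%N ->
  let l := L%:R / n%:R in
  0 <= l <= 1 /\ n%:R * Z l <= n%:R ^+ 2 * X (L.+1%:R / n%:R) - n%:R ^+ 2 * X l.
Proof.
move=> Ln l; have l0 : 0 <= l by rewrite divr_ge0.
have ll' : L.+1%:R / n%:R - l = n%:R^-1 by rewrite -natr1 /l; field; exact: lt0r_neq0.
have lt : l < L.+1%:R / n%:R by rewrite -subr_gt0 ll' invr_gt0.
have l'1 : L.+1%:R / n%:R <= 1 :> R by rewrite ler_pdivrMr // mul1r ler_nat.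
split; first by rewrite l0 (le_trans (ltW lt)).
have := X_step l0 lt l'1; rewrite ll' => /(ler_wpM2l (sqr_ge0 n%:R)).
by rewrite mulrBr mulrA expr2 mulfK ?lt0r_neq0.
Qed.

Lemma ode_budget_mono : {homo ode_budget : i j / (i <= j)%N >-> i <= j}.
Proof.
apply: homo_leq => //; first by move=> ? ? ?; exact: le_trans.
move=> L; rewrite /ode_budget -[L.+1%:R]natr1.
have [Ln|] := boolP (L < n)%N; last first.
  rewrite -leqNgt => nL.
  by rewrite !(minn_idPr _) //; [lra | exact: leqW].
have [l01] := ode_budget_step Ln.
have [/andP[Z0 _] _] := XZ l01.
have := mulr_ge0 (ltW n0) Z0.
rewrite (minn_idPl (ltnW Ln)) (minn_idPl Ln) -!mulrA; lra.
Qed.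

Lemma ode_budget_staircase : staircase_budget n ode_budget.
Proof.
move=> L k t Ln /andP[k0 kn] bound; rewrite /ode_budget.
rewrite (minn_idPl (ltnW Ln)) (minn_idPl Ln).
have [l01] := ode_budget_step Ln; have [/andP[]] := XZ l01.
move: (X (L.+1%:R / n%:R)) => x'.
have N10 : 10 <= n%:R :> R by rewrite (ler_nat R 10 n).
have K1 : 1 <= k%:R :> R by rewrite (ler_nat R 1 k).
have KN : k%:R <= n%:R :> R by rewrite ler_nat.
have L0 : 0 <= L%:R :> R by [].
have lE : L%:R = n%:R * (L%:R / n%:R) :> R by rewrite mulrC divfK // lt0r_neq0.
move: bound; rewrite -(ler_nat R) -!muln2 !natrD !natrM natrB //.
rewrite -[(n - k).+1%:R]natr1 -[n.+1%:R]natr1 -[L.+1%:R]natr1 natrB //.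
move: (L%:R / n%:R) lE => l; move: (Z l) (X l) => z x.
move: (n%:R : R) (k%:R : R) (t%:R : R) (L%:R : R) N10 K1 KN L0.
clear => N K t L N10 K1 KN L0 lE bound z0 z1 xE step tle.
(* If [K <= N z + 1], the [2 K] new chips are paid by [2 N z] from the growth of [X] and 2 from the
   linear term. *)
have [KNz|NzK] := leP K (N * z + 1); first by rewrite -!mulrA in tle *; lra.
(* Here [K = N z + 1 + d] with [d > 0]: so many tight steps force [t] to be
   smaller by about [N (1 - z) d], which outweighs the [2 d] extra chips. *)
pose d := K - N * z - 1; pose W := N - N * z.
have d0 : 0 < d by rewrite /d; lra.
have W5 : 5 <= W by rewrite /W; nra.
have dW : 1 + d <= W by rewrite /d /W; lra.
(* Of the [2 d W] subtracted in [bound], one [d W] absorbs [d (1 + d)] and the other the doubled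
   excess [4 d], as [W >= 5]. *)
have h : d * (1 + d) <= d * W by rewrite ler_wpM2l // ltW.
have h' : d * 5 <= d * W by rewrite ler_wpM2l // ltW.
have xN : 4 * N ^+ 2 * x = 2 * N * L - 2 * N ^+ 2 * z + N ^+ 2 * z ^+ 2.
  by rewrite (_ : 4 * N ^+ 2 * x = 2 * N ^+ 2 * (2 * x)); [rewrite xE lE; field | ring].
have bE : (N - K) * (N - K + 1) =
    N ^+ 2 - 2 * N ^+ 2 * z + N ^+ 2 * z ^+ 2 - W * (1 + 2 * d) + d * (1 + d).
  by rewrite /W /d; ring.
have NN : N * (N + 1) = N ^+ 2 + N by ring.
rewrite bE NN in bound; rewrite -!mulrA in bound xN step tle *.
have KE : K = N * z + 1 + d by rewrite /d; ring.
have WE : W * (1 + 2 * d) = W + 2 * (d * W) by ring.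
rewrite WE in bound.
suff : 2 * (t + K * 2) <= 2 * (2 * (N ^+ 2 * x') + 2 * (L + 1)) by lra.
lra.
Qed.
End Budget.

(** * Vanishing error terms and the asymptotic bound *)

Section Limits.
Variable R : realType.

Lemma cvg_invn (a : R) : a / n%:R @[n --> \oo] --> (0 : R).
Proof.
rewrite -(mulr0 a); apply: cvgM; first exact: cvg_cst.
by rewrite -(cvg_shiftS (fun n => n%:R^-1 : R)); exact: cvg_harmonic.
Qed.

Lemma cvg_inv_predn (a : R) : a / n.-1%:R @[n --> \oo] --> (0 : R).
Proof. by rewrite -(cvg_shiftS (fun n => a / n.-1%:R : R)); exact: cvg_invn. Qed.
End Limits.

Theorem theorem2p7 (R : realType) (y z : R -> R) (xplus : R)
    (hyz : toppling_ode y z)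
    (hxplus0 : 0 <= xplus) (hxplus : y xplus + z xplus = 1) :
  2 * xplus < (637 * 10 ^+ 3 + 152) / 10 ^+ 6 /\
  exists eps delta : nat -> R,
    [/\ eps n @[n --> \oo] --> 0,
        delta n @[n --> \oo] --> 0 &
        \forall n \near \oo,
          [/\ (toppling_length (complete_graph n))%:R
                <= (2 * xplus + eps n) * n%:R ^+ 2,
              (2 * xplus + eps n) * n%:R ^+ 2
                = (4 * xplus + delta n) * #|edges (complete_graph n)|%:R &
              (4 * xplus + delta n) * #|edges (complete_graph n)|%:R
                < (637 * 10 ^+ 3 + 152) / 10 ^+ 6 * n%:R ^+ 2]].
Proof.
have bound := ode_final_time_bound hyz hxplus0 hxplus; split=> //.
have [X [X1 X0 XZ X_step]] := ode_inverse_height hyz hxplus0 hxplus.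
(* The budget at [n] is [2 xplus n^2 + 2 n], whence [eps]; [delta] then solves the equality with
   [n (n - 1) / 2] edges. *)
exists (fun n => 2 / n%:R), (fun n => (4 * xplus + 4) / n.-1%:R).
split; [exact: cvg_invn | exact: cvg_inv_predn |].
move: bound; set C := (_ / _ : R) => bound.
have eps_small : \forall n \near \oo, 2 / n%:R < C - 2 * xplus.
  by apply: (cvgr_lt _ (cvg_invn 2)); rewrite subr_gt0.
near=> n.
have n10 : (10 <= n)%N by near: n; exact: nbhs_infty_ge.
have n0 : (n%:R : R) != 0 by rewrite pnatr_eq0; lia.
have n1 : (n.-1%:R : R) != 0 by rewrite pnatr_eq0; lia.
have edgesE : (2 * xplus + 2 / n%:R) * n%:R ^+ 2 =
    (4 * xplus + (4 * xplus + 4) / n.-1%:R) * #|edges (complete_graph n)|%:R :> R.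
  have e2 : 2 * ('C(n, 2))%:R = n%:R * n.-1%:R :> R.
    by rewrite -!natrM; congr _%:R; have := bin_ffact n 2; rewrite ffactnS ffactn1 mulnC.
  rewrite card_edges_complete.
  have -> : ('C(n, 2))%:R = n%:R * n.-1%:R / 2 :> R by rewrite -e2; field.
  have -> : n%:R = n.-1%:R + 1 :> R by rewrite natr1 prednK //; lia.
  by field; rewrite n1 natr1 prednK ?n0 //; lia.
split=> //.
  rewrite (le_trans (toppling_length_le (B := ode_budget X n) _ _ _ _)) //.
  - lia.
  - exact: (ode_budget_mono n10 XZ X_step).
  - apply: le_trans (ode_budget_mono n10 XZ X_step (leq0n 1)).
    by rewrite /ode_budget min0n mul0r mulr0 addr0 mulr_ge0.
  - exact: ode_budget_staircase n10 XZ X_step.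
  by rewrite /ode_budget minnn divff // X1 le_eqVlt; apply/orP; left; apply/eqP; field.
rewrite -edgesE ltr_pM2r; last by rewrite exprn_gt0 // lt0r n0 ler0n.
by rewrite -ltrBrDl; near: n.
Unshelve. all: by end_near.
Qed.
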